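(* Let $A$ be an $m\times n$ matrix over the extended tropical semiring $\mathbb{T}$. Then $A$ has tropical rank $k$ if and only if its maximal nonsingular minor is of size $k\times k$, i.e. if and only if $k$ is the largest integer such that $A$ has a tropically nonsingular $k\times k$ submatrix.
   Context: Extended tropical semiring. Let $\mathbb{T}=\mathbb{R}\cup\mathbb{R}^\nu\cup\{-\infty\}$, where $\mathbb{R}^\nu=\{a^\nu: a\in\mathbb{R}\}$ is a disjoint copy of $\mathbb{R}$ (the ghosts). Put $\bar{\mathbb{R}}=\mathbb{R}\cup\{-\infty\}$ and $\bar{\mathbb{U}}=\mathbb{R}^\nu\cup\{-\infty\}$. Extend $\nu$ to $\mathbb{T}$ by $(a^\nu)^\nu=a^\nu$, $(-\infty)^\nu=-\infty$. Total order $\prec$ on $\mathbb{T}$: $-\infty$ is the least element; for reals $a<b$: $a\prec b$, $a\prec b^\nu$, $a^\nu\prec b$, $a^\nu\prec b^\nu$; and $a\prec a^\nu$ for every $a\in\mathbb{R}$. Addition: $x\oplus y=\max_{\prec}\{x,y\}$ if $x\neq y$, $x\oplus x=x^\nu$ (so $(-\infty)\oplus(-\infty)=-\infty$). Multiplication: $a\odot b=a+b$, $a^\nu\odot b=a\odot b^\nu=a^\nu\odot b^\nu=(a+b)^\nu$ for $a,b\in\mathbb{R}$, and $(-\infty)\odot x=x\odot(-\infty)=-\infty$. This is a commutative semiring with zero $-\infty$ and unit $0$. Dependence and rank. Vectors $v_1,\dots,v_m\in\mathbb{T}^{(n)}$ (a family) are tropically dependent if there are $\alpha_1,\dots,\alpha_m\in\bar{\mathbb{R}}$,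 not all $-\infty$, with $\alpha_1v_1\oplus\cdots\oplus\alpha_mv_m\in\bar{\mathbb{U}}^{(n)}$; otherwise tropically independent. The tropical rank $\operatorname{rk}(A)$ of a matrix is the maximal number of tropically independent rows of $A$ (it may be $0$). Singularity and minors. For $A=(a_{i,j})\in M_{n\times n}(\mathbb{T})$ the tropical determinant is $|A|=\bigoplus_{\sigma\in S_n}a_{1,\sigma(1)}\cdots a_{n,\sigma(n)}$ (products in $\odot$). $A$ is tropically singular if $|A|\in\bar{\mathbb{U}}$, and tropically nonsingular otherwise. A minor of a matrix means a square submatrix obtained by deleting rows and columns. If there is no nonsingular minor of positive size, the maximal size is taken to be $0$. *)

(* Defs.v *)
From HB Require Import structures.
From mathcomp Require Import all_boot all_order all_fingroup all_algebra.
From mathcomp Require Import lra.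
From mathcomp Require Import boolp reals.

Set Implicit Arguments.
Unset Strict Implicit.
Unset Printing Implicit Defensive.

Import Order.TTheory GRing.Theory Num.Theory.
Local Open Scope ring_scope.

Variant trop (R : realType) : Type := NegInf | Tangible of R | Ghost of R.
Arguments NegInf {R}.

Section TropOrder.
Variable R : realType.
Implicit Types x y z : trop R.

Definition trop_code x : option (R + R) :=
  match x with
  | NegInf => None
  | Tangible a => Some (inl a)
  | Ghost a => Some (inr a)
  end.

Definition trop_decode (c : option (R + R)) : trop R :=
  match c with
  | None => NegInf
  | Some (inl a) => Tangible a
  | Some (inr a) => Ghost a
  end.

Lemma trop_codeK : cancel trop_code trop_decode.
Proof. by case. Qed.

HB.instance Definition _ := Choice.copy (trop R) (can_type trop_codeK).

Lemma tangible_eq (a b : R) : (Tangible a == Tangible b) = (a == b).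
Proof. by apply/eqP/eqP => [[]|->]. Qed.

Lemma ghost_eq (a b : R) : (Ghost a == Ghost b) = (a == b).
Proof. by apply/eqP/eqP => [[]|->]. Qed.

Definition trop_lt x y : bool :=
  match x, y with
  | _, NegInf => false
  | NegInf, _ => true
  | Tangible a, Tangible b => a < b
  | Tangible a, Ghost b => a <= b
  | Ghost a, Tangible b => a < b
  | Ghost a, Ghost b => a < b
  end.

Definition trop_le x y := (x == y) || trop_lt x y.

Lemma trop_lt_irr : irreflexive trop_lt.
Proof. by case=> //= a; rewrite ltxx. Qed.

Lemma trop_lt_trans : transitive trop_lt.
Proof. by case=> [|b|b] [|a|a] [|c|c] //=; lra. Qed.

Lemma trop_lt_total x y : x != y -> trop_lt x y || trop_lt y x.
Proof.
case: x y => [|a|a] [|b|b] //=; rewrite ?tangible_eq ?ghost_eq.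
- by rewrite neq_lt.
- by move=> _; case: leP.
- by move=> _; case: ltP.
- by rewrite neq_lt.
Qed.

Fact trop_display : Order.disp_t. Proof. exact: Order.Disp tt tt. Qed.

HB.instance Definition _ :=
  Order.LtOrder.Build trop_display (trop R)
    (fun _ _ => erefl) (fun _ _ => erefl) (fun _ _ => erefl)
    trop_lt_irr trop_lt_trans trop_lt_total.

End TropOrder.

Section TropSemiring.
Variable R : realType.
Implicit Types x y z : trop R.

Definition nu x : trop R :=
  match x with
  | NegInf => NegInf
  | Tangible a => Ghost a
  | Ghost a => Ghost a
  end.

Definition trop_add x y : trop R := if x == y then nu x else Order.max x y.

Definition trop_mul x y : trop R :=
  match x, y with
  | NegInf, _ => NegInf
  | _, NegInf => NegInf
  | Tangible a, Tangible b => Tangible (a + b)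
  | Ghost a, Tangible b => Ghost (a + b)
  | Tangible a, Ghost b => Ghost (a + b)
  | Ghost a, Ghost b => Ghost (a + b)
  end.

Lemma trop_addE x y :
  trop_add x y =
  match x, y with
  | NegInf, _ => y
  | _, NegInf => x
  | Tangible a, Tangible b =>
      if a < b then Tangible b else if b < a then Tangible a else Ghost a
  | Tangible a, Ghost b => if a <= b then Ghost b else Tangible a
  | Ghost a, Tangible b => if a < b then Tangible b else Ghost a
  | Ghost a, Ghost b => if a < b then Ghost b else Ghost a
  end.
Proof.
have maxE : Order.max x y = if trop_lt x y then y else x by [].
rewrite /trop_add maxE; case: x y {maxE} => [|a|a] [|b|b] //=;
  rewrite ?tangible_eq ?ghost_eq; by case: ltgtP => // ->.
Qed.

Lemma trop_addC : commutative trop_add.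
Proof.
by case=> [|a|a] [|b|b]; rewrite !trop_addE //; case: ltgtP => // ->.
Qed.

Lemma trop_add0 : left_id NegInf trop_add.
Proof. by case=> [|a|a]; rewrite trop_addE. Qed.

Lemma trop_addA : associative trop_add.
Proof.
by case=> [|a|a] [|b|b] [|c|c]; rewrite ?trop_addE //;
  do ?[case: ltgtP => ?; rewrite ?trop_addE //];
  subst; first [by [] | by exfalso; lra | by congr (_ _); lra].
Qed.

Lemma trop_mulA : associative trop_mul.
Proof. by case=> [|a|a] [|b|b] [|c|c] //=; rewrite addrA. Qed.

Lemma trop_mulC : commutative trop_mul.
Proof. by case=> [|a|a] [|b|b] //=; rewrite addrC. Qed.

Lemma trop_mul1 : left_id (Tangible 0) trop_mul.
Proof. by case=> [|a|a] //=; rewrite add0r. Qed.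

Lemma trop_mul0 : left_zero NegInf trop_mul.
Proof. by []. Qed.

Lemma trop_mulDl : left_distributive trop_mul trop_add.
Proof.
case=> [|a|a] [|b|b] [|c|c] //; rewrite ?trop_addE //=;
  rewrite ?trop_addE //= ?ltrD2r ?lerD2r;
  by do ?[case: ltgtP => //= ?]; subst.
Qed.

(* The semiring zero [0 : trop R] is [NegInf], the semiring unit [1 : trop R]
   is [Tangible 0]. *)
HB.instance Definition _ :=
  GRing.isNmodule.Build (trop R) trop_addA trop_addC trop_add0.

HB.instance Definition _ :=
  GRing.Nmodule_isComNzSemiRing.Build (trop R)
    trop_mulA trop_mulC trop_mul1 trop_mulDl trop_mul0 isT.

(* \bar R = R \cup {-oo} *)
Definition Rbar : {pred trop R} :=
  fun x => match x with Ghost _ => false | _ => true end.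

(* \bar U = R^nu \cup {-oo} *)
Definition Ubar : {pred trop R} :=
  fun x => match x with Tangible _ => false | _ => true end.

End TropSemiring.
Arguments Rbar {R}.
Arguments Ubar {R}.

Section Rank.
Variable R : realType.

Definition trop_dependent (I : finType) n (v : I -> 'rV[trop R]_n) : Prop :=
  exists alpha : I -> trop R,
    [/\ forall i, alpha i \in Rbar,
        exists i, alpha i != NegInf
      & forall j, (\sum_i alpha i *: v i) 0 j \in Ubar].

Definition trop_independent (I : finType) n (v : I -> 'rV[trop R]_n) : Prop :=
  ~ trop_dependent v.

Definition trop_rank m n (A : 'M[trop R]_(m, n)) : nat :=
  \max_(S : {set 'I_m} |
      `[< trop_independent (fun i : 'I_#|S| => row (enum_val i) A) >]) #|S|.

(* The sign-free determinant; \det of matrix.v needs a ring. *)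
Definition trop_det n (A : 'M[trop R]_n) : trop R :=
  \sum_(s : 'S_n) \prod_i A i (s i).

Definition trop_singular n (A : 'M[trop R]_n) : Prop := trop_det A \in Ubar.

Definition trop_nonsingular n (A : 'M[trop R]_n) : Prop := ~ trop_singular A.

(* The increasing maps f and g list the rows and columns which are kept. For
   k = 0 this always holds: the empty determinant is the unit Tangible 0. *)
Definition has_nonsingular_minor m n (A : 'M[trop R]_(m, n)) (k : nat) : Prop :=
  exists (f : 'I_k -> 'I_m) (g : 'I_k -> 'I_n),
    [/\ {homo f : i j / (i < j)%N},
        {homo g : i j / (i < j)%N}
      & trop_nonsingular (mxsub f g A)].

Definition max_nonsingular_minor m n (A : 'M[trop R]_(m, n)) : nat :=
  \max_(k < (minn m n).+1 | `[< has_nonsingular_minor A k >]) k.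

End Rank.

(* Main.v *)
(* A family of rows is dependent iff some nonzero [alpha] satisfies, for every
   tangible entry [a i j], the constraint that [alpha i * a i j] is dominated by
   [alpha i' * a i' j] for some other [i'].

   If the rows of a square matrix are dependent, follow in the column matched
   with [i] by an optimal permutation the row dominating row [i]. This walk
   closes up into a cycle, along which the [alpha i] cancel, and modifying the
   optimal permutation on that cycle gives another one which is at least as good.

   Conversely, suppose that no [alpha] satisfies all constraints. If two
   constraints concern the same row, solutions of the two systems lacking one of
   them could be merged into a solution of the full system, so one of the two
   smaller systems is already unsolvable. Iterating leaves one constraint
   [(i, sg i)] per row. If some nontrivial permutation were at least as good as
   the identity for the columns [sg], it would have a cycle of nonnegative weight,
   and potentials along that cycle would be a solution. Hence the columns [sg]
   give a nonsingular minor. *)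

Require Import Defs.
From mathcomp Require Import all_boot all_order all_fingroup all_algebra.
From mathcomp Require Import lra.
From mathcomp Require Import boolp reals.

Set Implicit Arguments.
Unset Strict Implicit.
Unset Printing Implicit Defensive.

Import Order.TTheory GRing.Theory Num.Theory.
Local Open Scope ring_scope.

(** * Comparison of values in the extended tropical semiring *)

Section NuOrder.
Variable R : realType.
Implicit Types (x y z : trop R) (a b : R).

(* The junk value at [NegInf] is 0. *)
Definition re x : R := match x with NegInf => 0 | Tangible a | Ghost a => a end.

Lemma trop_leE x y : (x <= y)%O = trop_le x y.
Proof. by []. Qed.

Lemma addE x y : x + y = trop_add x y. Proof. by []. Qed.
Lemma mulE x y : x * y = trop_mul x y. Proof. by []. Qed.

(** [nu] forgets whether an element is tangible or ghost, so this preorder compares real values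
    only. Domination is always expressed in it. *)
Lemma le_nuE x y : (nu x <= nu y)%O =
  (x == NegInf) || (y != NegInf) && (re x <= re y).
Proof.
rewrite trop_leE /trop_le.
by case: x y => [|a|a] [|b|b] //=; rewrite ghost_eq -le_eqVlt.
Qed.

Lemma le_nu x y : (x <= y)%O -> (nu x <= nu y)%O.
Proof.
rewrite le_nuE trop_leE /trop_le.
case: x y => [|a|a] [|b|b] //=; rewrite ?tangible_eq ?ghost_eq -?le_eqVlt //=.
by move/ltW.
Qed.

Lemma le_nuM2r z x y : (nu x <= nu y)%O -> (nu (x * z) <= nu (y * z))%O.
Proof.
by rewrite !le_nuE; case: x y z => [|a|a] [|b|b] [|c|c] //=; rewrite lerD2r.
Qed.

Lemma nuD x y : nu (x + y) = Order.max (nu x) (nu y).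
Proof.
have maxE u v : Order.max u v = if trop_lt u v then v else u :> trop R by [].
rewrite maxE addE trop_addE; case: x y {maxE} => [|a|a] [|b|b] //=;
  by case: ltgtP => // ->.
Qed.

Lemma addl_Ubar x y : x \in Ubar -> (nu y <= nu x)%O -> x + y \in Ubar.
Proof.
rewrite addE trop_addE le_nuE; case: x y => [|a|a] [|b|b] //= _.
by case: ltP.
by case: ltP.
Qed.

Lemma add_nu_eq x y : nu x = nu y -> x + y = nu x.
Proof.
by rewrite addE trop_addE; case: x y => [|a|a] [|b|b] //= [->];
  rewrite ?ltxx ?lexx.
Qed.

Lemma addr_small x y : (nu y < nu x)%O -> x + y = x.
Proof.
rewrite ltNge le_nuE addE trop_addE.
by case: x y => [|a|a] [|b|b] //=; case: ltgtP.
Qed.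

Lemma nu_sum_le (I : finType) (P : pred I) (F : I -> trop R) z :
  (forall i, P i -> (nu (F i) <= nu z)%O) ->
  (nu (\sum_(i | P i) F i) <= nu z)%O.
Proof.
move=> h; apply: (big_ind (fun x => (nu x <= nu z)%O)) => // [|x y hx hy].
  by rewrite le_nuE eqxx.
by rewrite nuD ge_max hx.
Qed.

Lemma nu_sum_ge (I : finType) (P : pred I) (F : I -> trop R) i :
  P i -> (nu (F i) <= nu (\sum_(j | P j) F j))%O.
Proof. by move=> Pi; rewrite (bigD1 i) //= nuD le_max lexx. Qed.

Lemma Ubar_max x y : nu x = nu y -> x + y \in Ubar.
Proof. by move/add_nu_eq->; case: x. Qed.

(** A tangible term of strictly largest value absorbs the rest of the sum. Without one, a term of
    maximal value is ghost or [NegInf], or it is tied with the rest, and the tie produces a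
    ghost. *)
Lemma sum_Ubar (I : finType) (F : I -> trop R) :
  \sum_i F i \in Ubar <->
  forall i, F i \notin Ubar ->
    exists2 i', i' != i & (nu (F i) <= nu (F i'))%O.
Proof.
split=> [sumU i FiU | domF].
  apply: contrapT => nodom.
  suff lt_rest : (nu (\sum_(j | j != i) F j) < nu (F i))%O.
    by move: sumU; rewrite (bigD1 i) //= addr_small ?(negbTE FiU).
  apply: (big_ind (fun x => (nu x < nu (F i))%O)) => [|x y hx hy|i' i'i].
  - by case: (F i) FiU.
  - by rewrite nuD gt_max hx.
  - by rewrite ltNge; apply/negP => le_i'; case: nodom; exists i'.
have [i1 _|I0] := pickP (fun _ : I => true); last by rewrite big_pred0.
case: (Order.TotalTheory.arg_maxP (fun i => nu (F i)) (isT : xpredT i1)).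
move=> i0 _ max0.
rewrite (bigD1 i0) //=.
have le0 : (nu (\sum_(i | i != i0) F i) <= nu (F i0))%O.
  by apply: nu_sum_le => i _; apply: max0.
have [F0U|/domF [i' i'0 le_i']] := boolP (F i0 \in Ubar).
  exact: addl_Ubar.
apply/Ubar_max/le_anti; rewrite le0 andbT.
exact: (le_trans le_i' (nu_sum_ge F i'0)).
Qed.

Lemma mul_eq0 x y : (x * y == NegInf) = (x == NegInf) || (y == NegInf).
Proof. by case: x y => [|a|a] [|b|b]. Qed.

Lemma mul_Ubar x y : (x * y \notin Ubar) = (x \notin Ubar) && (y \notin Ubar).
Proof. by case: x y => [|a|a] [|b|b]. Qed.

Lemma tangible_neq0 x : x \notin Ubar -> x != NegInf.
Proof. by case: x. Qed.

Lemma Rbar_tangible x : x \in Rbar -> x != NegInf -> x \notin Ubar.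
Proof. by case: x. Qed.

Lemma reM x y : x != NegInf -> y != NegInf -> re (x * y) = re x + re y.
Proof. by case: x y => [|a|a] [|b|b]. Qed.

Lemma prod_neq0_re (I : finType) (F : I -> trop R) :
  (forall i, F i != NegInf) ->
  (\prod_i F i != NegInf) /\ re (\prod_i F i) = \sum_i re (F i).
Proof.
move=> F0; apply: (big_ind2 (fun x a => x != NegInf /\ re x = a)) => //.
by move=> x _ y _ [x0 <-] [y0 <-]; rewrite mul_eq0 negb_or x0 y0 reM.
Qed.

Lemma prod_tangible (I : finType) (F : I -> trop R) :
  \prod_i F i \notin Ubar <-> forall i, F i \notin Ubar.
Proof.
split=> [FU i | FU].
  by move: FU; rewrite (bigD1 i) //= mul_Ubar => /andP[].
apply: (big_ind (fun x => x \notin Ubar)) => // x y xU yU.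
by rewrite mul_Ubar xU.
Qed.

Lemma prod_neq0 (I : finType) (F : I -> trop R) i :
  \prod_i F i != NegInf -> F i != NegInf.
Proof. by rewrite (bigD1 i) //= mul_eq0 negb_or => /andP[]. Qed.

End NuOrder.

(** * Cycles of permutations and of self-maps *)

Section Cycles.
Variables (R : realType) (I : finType).

(* With [P i t] the weight of the first [t] steps of the orbit of [i] and [N]
   the order of [pi], [P _ N] is constant on orbits, and on the orbits where it
   is nonnegative the maximum of [P i t] over [1 <= t <= N] is a potential. *)
Lemma perm_potential (w : I -> R) (pi : {perm I}) :
  pi != 1%g -> (forall i, pi i = i -> w i = 0) -> 0 <= \sum_i w i ->
  exists (X : {set I}) (p : I -> R), X != set0 /\
    forall i, i \in X -> [/\ pi i != i, pi i \in X & p i <= w i + p (pi i)].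
Proof.
move=> pi1 w0 sumw.
pose P i t := \sum_(s < t) w ((pi ^+ s)%g i); pose N := #[pi]%g.
have P0 i : P i 0%N = 0 by rewrite /P big_ord0.
have PS i t : P i t.+1 = w i + P (pi i) t.
  rewrite /P big_ord_recl expg0 perm1; congr (_ + _).
  by apply: eq_bigr => s _; rewrite expgS permM.
have PN i : P (pi i) N = P i N.
  apply: (@addrI _ (w i)); rewrite -PS /P big_ord_recr /= expg_order perm1.
  by rewrite addrC.
have sumP : 0 <= \sum_i P i N.
  rewrite exchange_big /=; apply: sumr_ge0 => s _.
  by move: sumw; rewrite (reindex_perm (pi ^+ s)%g).
have fixP i t : pi i = i -> P i t = 0.
  by move=> pii; elim: t => // t IHt; rewrite PS pii IHt w0 ?addr0.
exists [set i | (pi i != i) && (0 <= P i N)].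
(* [R] has no least element, so the maximum starts from its own term at [t = 0]. *)
exists (fun i => \big[Order.max/P i 1%N]_(t < N) P i t.+1); split.
  apply/negP => /eqP X0.
  have ltP0 i : pi i != i -> P i N < 0.
    move=> pii; rewrite ltNge; apply/negP => Pi.
    by have := in_set0 i; rewrite -X0 inE pii Pi.
  have [i0 i0P] : exists i, pi i != i.
    apply: contrapT => nofix; case/negP: pi1; apply/eqP/permP => i.
    by rewrite perm1; apply/eqP/negPn/negP => pii; case: nofix; exists i.
  move: sumP; rewrite (bigD1 i0) //= leNgt => /negP; apply.
  rewrite ltr_wnDr ?ltP0 //; apply: sumr_le0 => i _.
  by have [/fixP->|/ltP0/ltW] := eqVneq (pi i) i.
move=> i; rewrite !inE => /andP[pii Pi].
have N0 : (0 < N)%N by apply: order_gt0.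
split=> //; first by rewrite (inj_eq perm_inj) pii PN.
have le_p t : (t < N)%N ->
    P i t.+1 <= w i + \big[Order.max/P (pi i) 1%N]_(s < N) P (pi i) s.+1.
  (* For [t = 0] the sum left over is empty and outside the range of the maximum, but it is at most
     the full-period sum [P (pi i) N], which is nonnegative here. *)
  move=> tN; rewrite PS lerD2l; case: t tN => [_|t tN].
    rewrite P0 -PN -(prednK N0) in Pi *; apply: (le_trans Pi).
    by rewrite (le_trans _ (le_bigmax _ _ (Ordinal (ltnSn N.-1)))).
  exact: (le_bigmax _ _ (Ordinal (ltnW tN))).
by apply: bigmax_le => [|t _]; apply: le_p.
Qed.

(** Take [C] minimal among the nonempty [h]-stable subsets of [X]. Its image is again such a subset,
    hence no smaller, so [h] is injective on [C]. *)
Lemma stable_cycle (X : {set I}) (h : I -> I) :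
  X != set0 -> {in X, forall i, h i \in X} ->
  exists (C : {set I}) (pi : {perm I}), [/\ C != set0, C \subset X
    & forall i, pi i = if i \in C then h i else i].
Proof.
move=> X0 hX.
pose P (C : {set I}) := [&& C != set0, C \subset X & h @: C \subset C].
have PX : P X.
  by rewrite /P X0 subxx; apply/subsetP => _ /imsetP[i iX ->]; apply: hX.
case: (arg_minnP (fun C : {set I} => #|C|) PX) => C /and3P[C0 CX hC] minC.
have PhC : P (h @: C).
  apply/and3P; split; last exact: imsetS.
    by case/set0Pn: C0 => i iC; apply/set0Pn; exists (h i); apply: imset_f.
  exact: subset_trans CX.
have injh : {in C &, injective h}.
  by apply/imset_injP; rewrite eqn_leq leq_imset_card minC.
have hCC i : i \in C -> h i \in C.
  by move=> iC; apply: (subsetP hC); apply: imset_f.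
have inj : injective (fun i => if i \in C then h i else i).
  move=> i i'; case: ifP => iC; case: ifP => i'C //; first exact: injh.
    by move=> eqi; rewrite -eqi hCC in i'C.
  by move=> eqi; rewrite eqi hCC in iC.
by exists C, (perm inj); split=> // i; rewrite permE.
Qed.

End Cycles.

(** * From dependence to singularity, and solvability of domination constraints *)

Section Singular.
Variable R : realType.

Lemma dependent_singular n (B : 'M[trop R]_n) :
  trop_dependent (fun i => row i B) -> trop_singular B.
Proof.
move=> [al [alR [i0 al0] dep]]; apply/sum_Ubar => s /prod_tangible BsU.
pose X := [set i | al i != NegInf].
have X0 : X != set0 by apply/set0Pn; exists i0; rewrite inE.
have /choice [h hP] : forall i, exists i', al i != NegInf ->
    i' != i /\ (nu (al i * B i (s i)) <= nu (al i' * B i' (s i)))%O.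
  move=> i; have [ali|ali] := boolP (al i != NegInf); last by exists i.
  have := dep (s i); rewrite summxE => /sum_Ubar/(_ i).
  rewrite !mxE mul_Ubar BsU Rbar_tangible // => /(_ isT) [i' i'i].
  by rewrite !mxE; exists i'.
have hP' i : al i != NegInf -> [/\ h i != i, al (h i) != NegInf,
    B (h i) (s i) != NegInf &
    re (al i) + re (B i (s i)) <= re (al (h i)) + re (B (h i) (s i))].
  move=> ali; have [hi] := hP i ali; have := tangible_neq0 (BsU i) => Bi.
  rewrite le_nuE !mul_eq0 (negbTE ali) (negbTE Bi) /= negb_or -andbA.
  by case/and3P=> hal hB; rewrite !reM.
have hX : {in X, forall i, h i \in X}.
  by move=> i; rewrite !inE => /hP'[].
have [C [pi [C0 CX piE]]] := stable_cycle X0 hX.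
have piP i : B (pi i) (s i) != NegInf /\
    re (al i) + re (B i (s i)) <= re (al (pi i)) + re (B (pi i) (s i)).
  rewrite piE; case: ifP => [/(subsetP CX)|_]; last by rewrite tangible_neq0.
  by rewrite inE => /hP'[].
(* This permutation gives row [pi i] the column [s i] that row [i] had under [s]. *)
exists (pi^-1 * s)%g.
  case/set0Pn: C0 => i iC; apply/eqP => /permP/(_ (pi i)).
  rewrite permM permK => /perm_inj eqi.
  have hi : h i = i by rewrite {2}eqi piE iC.
  by have := subsetP CX _ iC; rewrite inE => /hP'[]; rewrite hi eqxx.
rewrite [X in (_ <= nu X)%O](reindex_perm pi) /=.
under [X in (_ <= nu X)%O]eq_bigr => i _ do rewrite permM permK.
rewrite le_nuE.
have [_ ->] := prod_neq0_re (fun i => tangible_neq0 (BsU i)).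
have [-> ->] := prod_neq0_re (fun i => (piP i).1).
(* The sum of the [re (al i)] is invariant under [pi], so adding it to both sides reduces the claim
   to [piP]. Rows with coefficient [NegInf] lie outside [C] and are fixed by [pi], so the junk value
   of [re] is harmless. *)
rewrite orbC /= -(lerD2l (\sum_i re (al i))) -big_split /=.
rewrite [X in _ <= X + _](reindex_perm pi) -big_split /=.
by rewrite ler_sum // => i _; case: (piP i).
Qed.

Definition feasible (I J : finType) (a : I -> J -> trop R) (C : {set I * J})
    (al : I -> trop R) : Prop :=
  [/\ forall i, al i \in Rbar, exists i, al i != NegInf &
      forall i j, (i, j) \in C -> al i != NegInf ->
        exists2 i', i' != i & (nu (al i * a i j) <= nu (al i' * a i' j))%O].

Lemma feasible_scale (I J : finType) (a : I -> J -> trop R) (C : {set I * J})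
    (al : I -> trop R) (c : R) :
  feasible a C al -> feasible a C (fun i => Tangible c * al i).
Proof.
move=> [alR [i0 al0] dom]; split=> [i||i j ijC].
- by have := alR i; case: (al i).
- by exists i0; rewrite mul_eq0 negb_or al0.
rewrite mul_eq0 negb_or /= => /(dom _ _ ijC)[i' i'i le_i'].
exists i' => //; rewrite -!mulrA mulrC [Tangible c * _]mulrC.
exact: le_nuM2r.
Qed.

(* Scaled so that both have the same finite value at [i], the two solutions can
   be replaced by their maximum: domination is monotone, and every constraint is
   met by one of the two solutions which attains the maximum at its row. *)
Lemma feasible_merge (I J : finType) (a : I -> J -> trop R) (C : {set I * J})
    (i : I) (j j' : J) (al be : I -> trop R) : j != j' ->
  feasible a (C :\ (i, j)) al -> feasible a (C :\ (i, j')) be ->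
  exists ga, feasible a C ga.
Proof.
move=> jj' fal fbe.
(* A solution vanishing at row [i] meets the dropped constraint vacuously. *)
have noconstr al' j1 : al' i = NegInf -> feasible a (C :\ (i, j1)) al' ->
    feasible a C al'.
  move=> ali [alR al0 dom]; split=> // l q lqC all.
  apply: dom => //; rewrite !inE lqC andbT; apply: contraNneq all => -[-> _].
  by rewrite ali.
case ali: (al i) => [|x|x].
- by exists al; apply: noconstr fal.
- case bei: (be i) => [|y|y].
  + by exists be; apply: noconstr fbe.
  + pose be' l := Tangible (x - y) * be l.
    have [alR [i0 al0] alP] := fal.
    have [beR _ beP] := feasible_scale (x - y) fbe.
    pose ga l := Order.max (al l) (be' l).
    exists ga; split.
    * by move=> l; rewrite /ga; case: leP => _; [apply: beR|apply: alR].
    * exists i0; rewrite /ga; case: leP => // al_le.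
      by apply: contraNneq al0 => be0; move: al_le; rewrite be0; case: (al i0).
    move=> l q lqC gal.
    have up (d : I -> trop R) : ga l = d l -> (forall l', (d l' <= ga l')%O) ->
        (exists2 i', i' != l & (nu (d l * a l q) <= nu (d i' * a i' q))%O) ->
        exists2 i', i' != l & (nu (ga l * a l q) <= nu (ga i' * a i' q))%O.
      move=> -> led [i' i'l le_i']; exists i' => //; apply: (le_trans le_i').
      exact/le_nuM2r/le_nu.
    have le_al l' : (al l' <= ga l')%O by rewrite /ga le_max lexx.
    have le_be l' : (be' l' <= ga l')%O by rewrite /ga le_max lexx orbT.
    have be'i : be' i = al i.
      by rewrite /be' bei ali mulE /= subrK.
    have gai : ga i = al i by rewrite /ga be'i maxxx.
    have [eq_al|eq_be] : ga l = al l /\ (l, q) != (i, j) \/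
                         ga l = be' l /\ (l, q) != (i, j').
    * have [li|li] := eqVneq l i.
        have [qj|qj] := eqVneq q j; [right|left].
          by rewrite li gai be'i qj xpair_eqE eqxx.
        by rewrite li gai xpair_eqE eqxx.
      by rewrite !xpair_eqE (negbTE li) /ga; case: leP => _; [right|left].
    * have [eq_l nlq] := eq_al; apply: (up al) => //.
      by apply: alP; rewrite -?eq_l // !inE nlq.
    * have [eq_l nlq] := eq_be; apply: (up be') => //.
      by apply: beP; rewrite -?[_ * _]/(be' l) -?eq_l // !inE nlq.
  + by have [beR _ _] := fbe; have := beR i; rewrite bei.
- by have [alR _ _] := fal; have := alR i; rewrite ali.
Qed.

(** With [w i] the gain from replacing row [i] by row [pi i] in column [sg i], the total gain is
    nonnegative. A potential [p] for [w], used as coefficients, makes row [pi i] dominate row [i] in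
    that column. *)
Lemma feasible_perm (I J : finType) (a : I -> J -> trop R) (C : {set I * J})
    (sg : I -> J) (pi : {perm I}) :
  (forall i j, (i, j) \in C -> j = sg i) ->
  (forall i, a i (sg i) \notin Ubar) -> pi != 1%g ->
  (nu (\prod_i a i (sg i)) <= nu (\prod_i a (pi i) (sg i)))%O ->
  exists al, feasible a C al.
Proof.
move=> Csg aU pi1; rewrite le_nuE.
have [/negbTE-> ->] := prod_neq0_re (fun i => tangible_neq0 (aU i)).
case/andP=> /prod_neq0 api0; have [_ ->] := prod_neq0_re api0 => le_re.
pose w i := re (a (pi i) (sg i)) - re (a i (sg i)).
have w0 i : pi i = i -> w i = 0 by rewrite /w => ->; rewrite subrr.
have sumw : 0 <= \sum_i w i by rewrite /w sumrB subr_ge0.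
have [X [p [/set0Pn[i0 i0X] Xp]]] := perm_potential pi1 w0 sumw.
exists (fun i => if i \in X then Tangible (p i) else NegInf); split.
- by move=> i; case: ifP.
- by exists i0; rewrite i0X.
move=> i j /Csg ->; case: ifP => // /Xp[pii piX le_p] _.
exists (pi i) => //; rewrite piX le_nuE !mul_eq0 /= api0.
rewrite !reM ?api0 ?tangible_neq0 //= orbC /=.
by move: le_p; rewrite /w; lra.
Qed.

Lemma feasible_or_transversal (I J : finType) (a : I -> J -> trop R)
    (C : {set I * J}) :
  (forall i j, (i, j) \in C -> a i j \notin Ubar) ->
  (exists al, feasible a C al) \/
  exists sg : I -> J, (forall i, a i (sg i) \notin Ubar) /\
    forall pi : {perm I}, pi != 1%g ->
      (nu (\prod_i a (pi i) (sg i)) < nu (\prod_i a i (sg i)))%O.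
Proof.
set Q := (X in _ \/ X).
have [N] := ubnP #|C|; elim: N C => // N IHN C; rewrite ltnS => leN CU.
have [[i [j [j' [ijC ij'C jj']]]]|nodouble] := pselect (exists i j j',
    [/\ (i, j) \in C, (i, j') \in C & j != j']).
  have sub q : (i, q) \in C -> (exists al, feasible a (C :\ (i, q)) al) \/ Q.
    move=> iqC; apply: IHN => [|l r]; last by rewrite inE => /andP[_ /CU].
    by rewrite (leq_trans _ leN) // [X in (_ < X)%N](cardsD1 (i, q)) iqC.
  have [[al fal]|] := sub _ ijC; last by right.
  have [[be fbe]|] := sub _ ij'C; last by right.
  by left; apply: feasible_merge jj' fal fbe.
(* A row without constraints gives a solution supported on that row alone. *)
have [[i iC]|noempty] := pselect (exists i, forall j, (i, j) \notin C).
  left; exists (fun l => if l == i then Tangible 0 else NegInf); split.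
  - by move=> l; case: ifP.
  - by exists i; rewrite eqxx.
  - move=> l j; case: (eqVneq l i) => [->|]; last by rewrite eqxx.
    by rewrite (negbTE (iC j)).
have /choice [sg sgC] : forall i, exists j, (i, j) \in C.
  move=> i; apply: contrapT => noj; case: noempty; exists i => j.
  by apply/negP => ijC; case: noj; exists j.
have Csg i j : (i, j) \in C -> j = sg i.
  move=> ijC; apply: contrapT => /eqP jsg; case: nodouble.
  by exists i, j, (sg i).
have aU i : a i (sg i) \notin Ubar by apply: CU.
have [[pi pi1 le_pi]|nopi] := pselect (exists2 pi : {perm I}, pi != 1%g &
    (nu (\prod_i a i (sg i)) <= nu (\prod_i a (pi i) (sg i)))%O).
  by left; apply: feasible_perm Csg aU pi1 le_pi.
right; exists sg; split=> // pi pi1; rewrite ltNge; apply/negP => le_pi.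
by apply: nopi; exists pi.
Qed.

Lemma independent_transversal (I : finType) n (v : I -> 'rV[trop R]_n) :
  trop_independent v ->
  exists sg : I -> 'I_n, (forall i, v i 0 (sg i) \notin Ubar) /\
    forall pi : {perm I}, pi != 1%g ->
      (nu (\prod_i v (pi i) 0 (sg i)) < nu (\prod_i v i 0 (sg i)))%O.
Proof.
pose C := [set ij | v ij.1 0 ij.2 \notin Ubar].
have [|[al [alR al0 dom]] []|//] :=
  @feasible_or_transversal _ _ (fun i j => v i 0 j) C.
  by move=> i j; rewrite inE.
exists al; split=> // j; rewrite summxE; apply/sum_Ubar => i.
rewrite !mxE mul_Ubar => /andP[ali vU].
have [|i' i'i le_i'] := dom i j _ (tangible_neq0 ali); first by rewrite inE.
by exists i' => //; rewrite mxE.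
Qed.

End Singular.

(** * Rank and nonsingular minors *)

Section Rank.
Variable R : realType.

Lemma trop_dependent_bij (I I' : finType) n (v : I -> 'rV[trop R]_n)
    (h : I' -> I) :
  bijective h -> trop_dependent v -> trop_dependent (v \o h).
Proof.
move=> bij_h [al [alR [i al0] dep]]; exists (al \o h); split.
- by move=> i'; apply: alR.
- by have [h' _ hK] := bij_h; exists (h' i); rewrite /= hK.
- by move=> j; have := dep j; rewrite (reindex h) //; apply: onW_bij.
Qed.

(** The enumeration of all ordinals is increasing, and filtering by [S] keeps it sorted. *)
Lemma enum_val_homo m (S : {set 'I_m}) :
  {homo @enum_val _ (mem S) : i j / (i < j)%N}.
Proof.
move=> i j ij; have x0 := enum_val i.
have srt : sorted ltn (map val (enum S)).
  rewrite sorted_map /enum_mem -enumT; apply: sorted_filter.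
    by move=> ? ? ?; apply: ltn_trans.
  by rewrite -sorted_map val_enum_ord iota_ltn_sorted.
have := sorted_ltn_nth ltn_trans (val x0) srt.
move/(_ i j); rewrite !inE size_map -cardE !ltn_ord => /(_ isT isT ij).
by rewrite !(enum_val_nth x0) !(nth_map x0) // -cardE.
Qed.

Lemma increasing_enum m (S : {set 'I_m}) k : #|S| = k ->
  exists f : 'I_k -> 'I_m,
    {homo f : i j / (i < j)%N} /\ {in S, forall x, exists i, f i = x}.
Proof.
move=> <-; exists (@enum_val _ (mem S)); split=> [|x xS].
  exact: enum_val_homo.
by exists (enum_rank_in xS x); rewrite enum_rankK_in.
Qed.

Lemma homo_ltn_inj k m (f : 'I_k -> 'I_m) :
  {homo f : i j / (i < j)%N} -> injective f.
Proof.
move=> homof i j eqf; apply: contrapT => /eqP.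
by rewrite -val_eqE neq_ltn => /orP[] /homof; rewrite eqf ltnn.
Qed.

(** A dependence among the rows chosen by [f] restricts to the columns chosen by [g], making the
    minor singular. *)
Lemma minor_le_rank m n (A : 'M[trop R]_(m, n)) k :
  has_nonsingular_minor A k -> (k <= trop_rank A)%N.
Proof.
move=> [f [g [/homo_ltn_inj injf _ ns]]].
have cardS : #|f @: 'I_k| = k by rewrite card_imset ?card_ord.
rewrite -[X in (X <= _)%N]cardS /trop_rank.
apply: (@leq_bigmax_cond _ _ (fun S : {set 'I_m} => #|S|)).
apply/asboolP => dep; apply: ns; apply: dependent_singular.
have fS i : f i \in f @: 'I_k by apply: imset_f.
pose h i := enum_rank_in (fS i) (f i).
have hK i : enum_val (h i) = f i by rewrite enum_rankK_in.
have bij_h : bijective h.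
  apply: inj_card_bij; last by rewrite !card_ord cardS.
  by move=> i j eqh; apply: injf; rewrite -!hK eqh.
have [al [alR al0 depf]] := trop_dependent_bij bij_h dep.
exists al; split=> // j; have := depf (g j); rewrite !summxE.
under eq_bigr => i _ do rewrite !mxE /= hK.
by under [X in _ -> X \in _]eq_bigr => i _ do rewrite !mxE.
Qed.

Lemma rank_has_minor m n (A : 'M[trop R]_(m, n)) :
  has_nonsingular_minor A (trop_rank A).
Proof.
pose P := [pred S : {set 'I_m} |
  `[< trop_independent (fun i : 'I_#|S| => row (enum_val i) A) >]].
(* The empty family is independent, so the maximum defining the rank is attained. *)
have [|S /asboolP indS rankE] := @eq_bigmax_cond _ P (fun S => #|S|).
  apply/card_gt0P; exists set0; apply/asboolP => -[al [_ [i _] _]].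
  by have := enum_valP i; rewrite inE.
have -> : trop_rank A = #|S| by exact: rankE.
have [sg [aU opt]] := independent_transversal indS.
(* If two rows shared a column, transposing them would leave the product unchanged, against strict
   optimality. *)
have inj_sg : injective sg.
  move=> i j eqs; apply: contrapT => /eqP ij.
  have /opt : tperm i j != 1%g.
    apply: contraNneq ij => /permP/(_ i); rewrite tpermL perm1 => ->.
    exact: eqxx.
  rewrite [X in (X < _)%O](_ : _ = nu (\prod_i0 row (enum_val i0) A 0 (sg i0))).
    by rewrite ltxx.
  congr nu; rewrite (reindex_perm (tperm i j)) /=; apply: eq_bigr => l _.
  by rewrite tpermK; congr (row _ _ _ _); case: tpermP => [->|->|].
have cardT : #|sg @: 'I_(#|S|)| = #|S| by rewrite card_imset ?card_ord.
have [g [homog gT]] := increasing_enum cardT.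
(* [sg] need not be increasing; [s0] is the permutation relating it to the increasing list [g] of
   the same columns. *)
have /choice [s0 gs0] : forall i, exists i', g i' = sg i.
  by move=> i; apply/gT/imset_f.
have inj_s0 : injective s0.
  by move=> i j eqs; apply: inj_sg; rewrite -!gs0 eqs.
exists enum_val, g; split=> //; first exact: enum_val_homo.
have prodE (s : 'S_#|S|) : \prod_i mxsub enum_val g A i (s i) =
    \prod_i row (enum_val (((perm inj_s0) * s^-1)%g i)) A 0 (sg i).
  rewrite (reindex_perm ((perm inj_s0) * s^-1)%g); apply: eq_bigr => i _.
  by rewrite !mxE permM permKV permE gs0.
(* The determinant term of [s0] is the tangible product along [sg], and by [opt] every other term
   has strictly smaller value. *)
move=> /sum_Ubar/(_ (perm inj_s0)); rewrite prodE mulgV.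
under eq_bigr => i _ do rewrite perm1.
have /prod_tangible prodU := aU; case=> // s s_neq; rewrite prodE leNgt.
by rewrite opt // -eq_mulgV1 eq_sym.
Qed.

End Rank.

Theorem corollary3p12 (R : realType) (m n : nat) (A : 'M[trop R]_(m, n))
    (k : nat) :
  (trop_rank A = k <-> max_nonsingular_minor A = k) /\
  (trop_rank A = k <->
     has_nonsingular_minor A k /\
     (forall l : nat, has_nonsingular_minor A l -> (l <= k)%N)).
Proof.
set r := trop_rank A.
have ler l : has_nonsingular_minor A l -> (l <= r)%N by apply: minor_le_rank.
have minr : has_nonsingular_minor A r by apply: rank_has_minor.
have maxE : max_nonsingular_minor A = r.
  apply/eqP; rewrite eqn_leq; apply/andP; split.
    by apply/bigmax_leqP => l /asboolP/ler.
  (* The maximum ranges only over sizes up to [minn m n], so [r] must be shown to lie in that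
     range. *)
  have r_lt : (r < (minn m n).+1)%N.
    have [f [g [/homo_ltn_inj injf /homo_ltn_inj injg _]]] := minr.
    have := leq_card f injf; have := leq_card g injg.
    by rewrite !card_ord ltnS leq_min => -> ->.
  pose size (l : 'I_(minn m n).+1) : nat := l.
  by apply: (@leq_bigmax_cond _ _ size (Ordinal r_lt)); apply/asboolP.
rewrite maxE; split=> //; split=> [<- // | [mink lek]].
by apply/eqP; rewrite eqn_leq ler // lek.
Qed.
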